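(* Let $\mathbb{F}$ be a field, let $F$ be a finite forest, let $M\in\mathcal{M}_{\mathbb{F},0}(F)$, and let $\vec{x}\in\mathbb{F}^{V(F)}$. Then $\vec{x}\in\mathrm{Null}(M)$ if and only if for every supp-transversal set $U$ of $M$ we have $D^{(M,U)}\vec{x}\in\mathrm{Null}(A(F))$.
   Context: All graphs are finite, undirected, without loops or multiple edges. $\mathbb{F}$ is an arbitrary field. For a graph $G$, $\mathcal{M}_{\mathbb{F},0}(G)$ is the set of all (not necessarily symmetric) matrices $M$ over $\mathbb{F}$ with rows and columns indexed by $V(G)$, with all diagonal entries zero, and such that for distinct $u,w\in V(G)$ the entry $M_{u,w}$ is nonzero if and only if $\{u,w\}\in E(G)$. $A(G)$ is the adjacency matrix of $G$, viewed as a $(0,1)$-matrix over $\mathbb{F}$. $\mathrm{Null}(M)=\{\vec{x}\in\mathbb{F}^{V(G)}: M\vec{x}=0\}$. The null support $\mathrm{Supp}(M)$ is the set of vertices $w\in V(G)$ such that some $\vec{x}\in\mathrm{Null}(M)$ has $\vec{x}_w\neq 0$. For vertices $v,w$ in the same connected component of a forest $F$, $vPw$ denotes the unique directed path from $v$ to $w$; $(a,b)\in vPw$ means that $a,b$ are consecutive vertices of this path with $a$ preceding $b$. For $M\in\mathcal{M}_{\mathbb{F},0}(F)$ and $v\in V(F)$, define for $w$ in the same component as $v$ $$D^{(M,v)}_{w,w}=\prod_{\substack{(u,t)\in vPw\\ u\in\mathrm{Supp}(M)}}M_{t,u}^{-1}\ \prod_{\substack{(t,u)\in vPw\\ u\in\mathrm{Supp}(M)}}M_{t,u}$$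 (empty products equal $1$), and $D^{(M,v)}_{w,w}=1$ if $v$ and $w$ lie in different components. For a set $U\subset V(F)$ with at most one vertex in each connected component of $F$, the $U$-scalation $D^{(M,U)}$ of $M$ is the non-singular diagonal matrix with $D^{(M,U)}_{w,w}=\prod_{v\in U}D^{(M,v)}_{w,w}$. A set $U\subset\mathrm{Supp}(M)$ with at most one vertex in each connected component of $F$ is supp-transversal of $M$ if $U\cap V(T_i)\neq\emptyset$ for every connected component $T_i$ of $F$ with $\mathrm{Supp}(M)\cap V(T_i)\neq\emptyset$. *)

(* Defs.v *)
From mathcomp Require Import all_boot all_order all_algebra.
From mathcomp Require Import boolp.
Set Implicit Arguments.
Unset Strict Implicit.
Unset Printing Implicit Defensive.
Import GRing.Theory.
Local Open Scope ring_scope.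

Record sgraph := SGraph {
  vertex :> finType;
  edge : rel vertex;
  edge_sym : symmetric edge;
  edge_irr : irreflexive edge }.

(* [ucycle] also accepts [:: u; w] for an edge uw (going back and forth), so
   the genuine graph cycles are those of size at least 3. *)
Definition forest (G : sgraph) : Prop :=
  forall c : seq G, ucycle (@edge G) c -> (size c < 3)%N.

Definition component (G : sgraph) (v : G) : {set G} :=
  [set w | connect (@edge G) v w].

Definition components (G : sgraph) : {set {set G}} :=
  [set component v | v : G].

(* The path from v to w is v :: p. *)
Definition simple_path (G : sgraph) (v w : G) (p : seq G) : bool :=
  [&& path (@edge G) v p, last v p == w & uniq (v :: p)].

(* vPw without its initial vertex v; in a forest, a simple path between two
   vertices of the same component exists and is unique, so that the choice made
   by [xchoose] is immaterial.  The value is irrelevant across components. *)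
Definition the_path (G : sgraph) (v w : G) : seq G :=
  if pselect (exists p, simple_path v w p) is left ex then xchoose ex else [::].

(* The pairs (a, b) of consecutive vertices of vPw, a preceding b. *)
Definition arcs (G : sgraph) (v w : G) : seq (G * G) :=
  zip (v :: the_path v w) (the_path v w).

Section Matrices.
Variables (K : fieldType) (G : sgraph).
Implicit Types (M : 'M[K]_#|G|) (U : {set G}).

(* Rows and columns are indexed by V(G) through the enumeration of G. *)
Definition mxentry M (u w : G) : K := M (enum_rank u) (enum_rank w).

Definition cventry (x : 'cV[K]_#|G|) (w : G) : K := x (enum_rank w) 0.

Definition graph_mx0 M : Prop :=
  (forall u, mxentry M u u = 0) /\
  (forall u w, u != w -> (mxentry M u w != 0) = edge u w).

Definition adj_mx : 'M[K]_#|G| :=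
  \matrix_(i, j) (edge (enum_val i) (enum_val j))%:R.

Definition null M : {pred 'cV[K]_#|G|} := [pred x | M *m x == 0].

Definition supp M : {set G} :=
  [set w | `[< exists2 x, x \in null M & cventry x w != 0 >]].

Definition vertex_scal M (v w : G) : K :=
  if connect (@edge G) v w then
    (\prod_(a <- arcs v w | a.1 \in supp M) (mxentry M a.2 a.1)^-1) *
    (\prod_(a <- arcs v w | a.2 \in supp M) mxentry M a.1 a.2)
  else 1.

Definition scalation M U : 'M[K]_#|G| :=
  diag_mx (\row_i \prod_(v in U) vertex_scal M v (enum_val i)).

Definition supp_transversal M U : Prop :=
  [/\ U \subset supp M,
      forall C, C \in components G -> (#|U :&: C| <= 1)%N
    & forall C, C \in components G -> supp M :&: C != set0 -> U :&: C != set0].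

End Matrices.

Arguments adj_mx : clear implicits.

(* Main.v *)
(* A zero-diagonal matrix M of a forest F equals A(F) up to multiplying rows and
   columns by nonzero scalars (these are computed from the roots outwards), so M
   and A(F) have the same null support S. The set S is independent: if an edge uw
   had both ends in S, then, the null space being graded by the bipartition of F,
   there would be null vectors x, y of A(F) with x_u, y_w nonzero and
   x_w = y_u = 0, while evaluating y^T A x on the component of u in F - uw in two
   ways gives x_u y_w = y_u x_w. Hence for t outside S and its neighbours u in S
   the scalation satisfies D_u = D_t M_{t,u}, so on vectors supported in S row t
   of A D is row t of M times D_t, while for t in S both rows vanish. *)
Require Import Defs.
From mathcomp Require Import all_boot all_order all_algebra.
From mathcomp Require Import boolp.
Set Implicit Arguments.
Unset Strict Implicit.
Unset Printing Implicit Defensive.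
Import GRing.Theory.
Local Open Scope ring_scope.

(** * Paths in a forest: uniqueness, extension by an edge, recursion and cuts *)

Lemma edge_connect_sym (G : sgraph) : connect_sym (@edge G).
Proof. exact/sym_connect_sym/edge_sym. Qed.

Lemma edge_neq (G : sgraph) (u w : G) : edge u w -> u != w.
Proof. by apply: contraTneq => ->; rewrite edge_irr. Qed.

Section SimplePaths.
Variable G : sgraph.
Implicit Types (u v w : G) (p q : seq G).

Lemma simple_path_rcons v w u p : simple_path v w p -> edge w u ->
  u \notin v :: p -> simple_path v u (rcons p u).
Proof.
case/and3P=> pp /eqP lp up wu unp; apply/and3P; split.
- by rewrite rcons_path pp lp.
- by rewrite last_rcons.
- by rewrite -rcons_cons rcons_uniq unp up.
Qed.

Lemma simple_path_prefix v w u p :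
  simple_path v w (rcons p u) -> w = u /\ simple_path v (last v p) p.
Proof.
rewrite /simple_path rcons_path last_rcons -rcons_cons rcons_uniq eqxx.
by case/and3P => /andP[-> _] /eqP -> /andP[_ ->].
Qed.

Hypothesis hG : forest G.

(* Otherwise the part of the path from u to w closes up to a cycle. *)
Lemma forest_last_edge v w u p : simple_path v w p -> edge w u ->
  u \in v :: p -> exists2 q, p = rcons q w & simple_path v u q.
Proof.
move=> sp wu; have /and3P[pp /eqP lp up] := sp => up'.
case/splitPl: up' pp lp up sp => p1 p2 l1.
rewrite cat_path last_cat l1 -cat_cons cat_uniq.
case/andP=> pp1 pp2 lp2 /and3P[u1 /hasPn h12 u2] sp.
have uc : uniq (u :: p2).
  rewrite /= u2 andbT; apply/negP => /h12 /negP; apply.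
  by rewrite -l1 mem_last.
have : (size (u :: p2) < 3)%N.
  apply: hG; rewrite /ucycle uc andbT /=.
  by rewrite rcons_path pp2 lp2.
(* The bound leaves [p2] empty, which would make the edge a loop, or reduced to the single vertex
   [w]. *)
case: p2 lp2 {pp2 h12 u2 uc} sp => [|a [|//]] /=.
  by move=> e; rewrite e edge_irr in wu.
move=> -> sp _; exists p1; first by rewrite cats1.
by apply/and3P; split=> //; apply/eqP.
Qed.

(** Induction on [p] from its end. If the vertex a before [w] on [p] lies on [q], it also precedes
    [w] there, and the induction hypothesis applies to both prefixes. Otherwise [q] extended by a is
    a simple path to a, hence equals [p] without [w], so [p] would visit [w] twice. *)
Lemma simple_path_unique v w p q :
  simple_path v w p -> simple_path v w q -> p = q.
Proof.
elim/last_ind: p w q => [|p x IH] w q sp sq.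
  case/and3P: sp => _ /= /eqP ew _; case/and3P: sq => _ lq uq; subst w.
  case: q lq uq => //= a q /eqP lq.
  by rewrite -{1}lq mem_last.
have [ew sp'] := simple_path_prefix sp; subst x.
have aw : edge (last v p) w.
  by case/and3P: sp; rewrite rcons_path => /andP[].
have [inq|ninq] := boolP (last v p \in v :: q).
  rewrite edge_sym in aw.
  by have [q' -> sq'] := forest_last_edge sq aw inq; rewrite (IH _ _ sp' sq').
rewrite edge_sym in aw.
have := IH _ _ sp' (simple_path_rcons sq aw ninq) => ep.
have /and3P[_ _] := sp; rewrite -rcons_cons rcons_uniq ep => /andP[/negP[]].
rewrite inE mem_rcons inE; case/and3P: sq => _ /eqP <- _.
by move: (mem_last v q); rewrite inE => /orP[->//|->]; rewrite !orbT.
Qed.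

Lemma the_pathP v w : connect (@edge G) v w -> simple_path v w (the_path v w).
Proof.
move=> c; rewrite /the_path; case: pselect => [ex|nex]; first exact: xchooseP.
case: nex; case/connectP: c => p pp ->.
by case/shortenP: pp => q pq uq _; exists q; apply/and3P.
Qed.

Lemma the_path_refl v : the_path v v = [::].
Proof.
apply: (@simple_path_unique v v) => //; first exact: the_pathP.
by rewrite /simple_path /= eqxx.
Qed.

Lemma the_path_edge v u w : connect (@edge G) v u -> edge u w ->
  the_path v w = rcons (the_path v u) w \/ the_path v u = rcons (the_path v w) u.
Proof.
move=> cu uw; have su := the_pathP cu.
have sw := the_pathP (connect_trans cu (connect1 uw)).
have [inp|ninp] := boolP (w \in v :: the_path v u).
  right; have [q eq sq] := forest_last_edge su uw inp.
  by rewrite eq (simple_path_unique sq sw).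
by left; apply: simple_path_unique sw _; apply: simple_path_rcons su uw ninp.
Qed.

Lemma arcs_rcons v u w : connect (@edge G) v u ->
  the_path v w = rcons (the_path v u) w -> arcs v w = rcons (arcs v u) (u, w).
Proof.
move=> /the_pathP /and3P[_ /eqP lu _] e; rewrite /arcs e.
rewrite -[in (u, w)]lu; move: (the_path v u) => p.
by elim: p v {e lu} => //= a p IH v; rewrite IH.
Qed.

(** Each component is rooted and [step] is folded along the path from the root, starting with [t0].
    The disjunction hides the roots: one end of each edge is the parent of the other. *)
Lemma forest_recursion (T : Type) (t0 : T) (step : G -> G -> T -> T) :
  exists f : G -> T, forall u w, edge u w ->
    f w = step u w (f u) \/ f u = step w u (f w).
Proof.
pose rt := fingraph.root (@edge G).
(* The accumulator carries the current vertex, since [step] needs both ends of the edge being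
   traversed. *)
pose g (a : G * T) (w : G) := (w, step a.1 w a.2).
have gE v p : (foldl g (v, t0) p).1 = last v p.
  by elim/last_ind: p => //= p x _; rewrite foldl_rcons last_rcons.
exists (fun w => (foldl g (rt w, t0) (the_path (rt w) w)).2) => u w uw.
have cw : connect (@edge G) u w := connect1 uw.
have -> : rt w = rt u by symmetry; apply/(fingraph.rootP (@edge_connect_sym G)).
have cu : connect (@edge G) (rt u) u.
  by rewrite edge_connect_sym connect_root.
have ru := the_pathP cu; have rw := the_pathP (connect_trans cu cw).
case: (the_path_edge cu uw) => ->; rewrite foldl_rcons; [left|right] => /=.
  by rewrite gE; case/and3P: ru => _ /eqP ->.
by rewrite gE; case/and3P: rw => _ /eqP ->.
Qed.

Lemma forest_bipartite : exists c : G -> bool, forall u w, edge u w -> c w = ~~ c u.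
Proof.
have [c hc] := forest_recursion true (fun _ _ => negb).
by exists c => u w /hc[] -> //; rewrite negbK.
Qed.

(** [C] is the component of [u] once the edge is deleted; a path to [w] avoiding that edge would be
    a second simple path between its ends. *)
Lemma forest_edge_cut u w : edge u w -> exists C : {set G},
  [/\ u \in C, w \notin C & forall s t, s \in C -> edge s t ->
       (t \in C) || ((s == u) && (t == w))].
Proof.
move=> uw; pose e := [rel s t : G | edge s t && ([set s; t] != [set u; w])].
have nw : ~~ connect e u w.
  apply/negP => /connectP[p pp lp]; case/shortenP: pp lp => q pq uq _ lq.
  have sq : simple_path u w q.
    by apply/and3P; split; rewrite ?lq //; apply: sub_path pq => ? ? /andP[].
  have sw : simple_path u w [:: w].
    by rewrite /simple_path /= uw eqxx inE edge_neq.
  by move: pq; rewrite (simple_path_unique sq sw) /= eqxx !andbF.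
exists [set s | connect e u s]; split; rewrite ?inE ?connect0 // => s t.
rewrite !inE => cs st; have [/eqP est|ne] := boolP ([set s; t] == [set u; w]).
  have := set21 s t; have := set22 s t; rewrite est !inE.
  case/orP => /eqP et; case/orP => /eqP es; subst s t.
  - by rewrite connect0.
  - by rewrite connect0.
  - by rewrite !eqxx orbT.
  - by rewrite cs.
by rewrite (connect_trans cs) // connect1 //= st ne.
Qed.

End SimplePaths.

(** * Null vectors and matrix rows in terms of vertices *)

Section NullSpaces.
Variables (K : fieldType) (G : sgraph).
Implicit Types (M : 'M[K]_#|G|) (f g : G -> K) (u w s t : G).

(** Null vectors as functions on vertices, so that sums run over vertices instead of enumeration
    indices. *)
Definition null_fun M f : Prop := forall t, \sum_u mxentry M t u * f u = 0.

Lemma nullP M (x : 'cV[K]_#|G|) : x \in null M <-> null_fun M (cventry x).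
Proof.
have E t : (M *m x) (enum_rank t) 0 = \sum_u mxentry M t u * cventry x u.
  rewrite mxE (reindex (@enum_rank G)) //=.
  exact/onW_bij/enum_rank_bij.
rewrite inE; split=> [/eqP h t|h]; first by rewrite -E h mxE.
apply/eqP/matrixP => i j; rewrite (ord1 j) -(enum_valK i) E h mxE //.
Qed.

Lemma suppP M w :
  reflect (exists2 f, null_fun M f & f w != 0) (w \in supp M).
Proof.
rewrite inE; apply: (iffP (asboolP _)) => [[x /nullP hx xw]|[f hf fw]].
  by exists (cventry x).
have E : cventry (\col_i f (enum_val i)) =1 f.
  by move=> u; rewrite /cventry mxE enum_rankK.
exists (\col_i f (enum_val i)); last by rewrite E.
by apply/nullP => t; rewrite -[RHS](hf t); apply: eq_bigr => u _; rewrite E.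
Qed.

Lemma mxentry_adj u w : mxentry (adj_mx K G) u w = (edge u w)%:R.
Proof. by rewrite /mxentry mxE !enum_rankK. Qed.

Lemma adj_row t f :
  \sum_u mxentry (adj_mx K G) t u * f u = \sum_(u | edge t u) f u.
Proof.
rewrite [RHS]big_mkcond; apply: eq_bigr => u _.
by rewrite mxentry_adj; case: edge; rewrite ?mul1r ?mul0r.
Qed.

Lemma mxentry_neq0 M u w : graph_mx0 M -> (mxentry M u w != 0) = edge u w.
Proof.
case=> h0 h1; have [->|/h1//] := eqVneq u w.
by rewrite h0 eqxx edge_irr.
Qed.

Lemma graph_mx0_row M t f : graph_mx0 M ->
  \sum_u mxentry M t u * f u = \sum_(u | edge t u) mxentry M t u * f u.
Proof.
move=> hM; rewrite [RHS]big_mkcond; apply: eq_bigr => u _.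
rewrite -(mxentry_neq0 _ _ hM); case: eqP => [->|//].
by rewrite mul0r.
Qed.

(** * The null support over a forest: scaling to the adjacency matrix, independence *)

Hypothesis hG : forest G.

Lemma forest_mx_scaling M : graph_mx0 M -> exists r c : G -> K,
  (forall u, r u != 0 /\ c u != 0) /\
  (forall u w, edge u w -> r u * mxentry M u w * c w = 1).
Proof.
move=> hM.
(* Pairs hold the row and column scalars. Those of a child [w] are forced by those of its parent [u]
   through the equations for the entries (w,u) and (u,w). *)
pose step u w (a : K * K) := ((mxentry M w u * a.2)^-1, (a.1 * mxentry M u w)^-1).
pose nz (a : K * K) := (a.1 != 0) && (a.2 != 0).
(* Replacing zero values by 1 makes the invariant [nz] hold by construction. *)
pose fix1 (a : K * K) := if nz a then a else (1, 1).
have nz1 a : nz (fix1 a) by rewrite /fix1; case: ifP; rewrite // /nz oner_eq0.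
have stepnz u w a : edge u w -> nz a -> nz (step u w a).
  move=> uw /andP[a1 a2]; rewrite /nz /step /= !invr_eq0 !mulf_neq0 //.
    by rewrite mxentry_neq0.
  by rewrite mxentry_neq0 // edge_sym.
have [f hf] := forest_recursion hG (1, 1) (fun u w a => step u w (fix1 a)).
pose h u := fix1 (f u).
have hh u w : edge u w -> h w = step u w (h u) \/ h u = step w u (h w).
  move=> uw; case: (hf u w uw) => e; [left|right]; rewrite /h [in LHS]e.
    by rewrite /fix1 stepnz ?nz1.
  by rewrite /fix1 stepnz ?nz1 // edge_sym.
have h1 u : (h u).1 != 0 by case/andP: (nz1 (f u)).
have h2 u : (h u).2 != 0 by case/andP: (nz1 (f u)).
exists (fun u => (h u).1), (fun u => (h u).2); split=> // u w uw.
have m0 : mxentry M u w != 0 by rewrite mxentry_neq0.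
case: (hh u w uw) => -> /=; first by rewrite mulfV // mulf_neq0.
by rewrite -mulrA mulVf // mulf_neq0.
Qed.

(** Multiplication by the column scalars [c] maps the null space of the adjacency matrix onto that
    of [M], and it preserves the zero pattern of each vector. *)
Lemma supp_adj M : graph_mx0 M -> supp (adj_mx K G) = supp M.
Proof.
move=> hM; have [r [c [nz rc]]] := forest_mx_scaling hM.
have r0 u : r u != 0 by case: (nz u).
have c0 u : c u != 0 by case: (nz u).
have E t f : r t * (\sum_u mxentry M t u * (c u * f u)) =
             \sum_u mxentry (adj_mx K G) t u * f u.
  rewrite adj_row graph_mx0_row // mulr_sumr; apply: eq_bigr => u tu.
  by rewrite !mulrA rc // mul1r.
apply/setP => w; apply/suppP/suppP => -[f hf fw].
  exists (fun u => c u * f u); last by rewrite mulf_neq0.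
  by move=> t; apply: (mulfI (r0 t)); rewrite E hf mulr0.
exists (fun u => (c u)^-1 * f u); last by rewrite mulf_neq0 ?invr_eq0.
move=> t; rewrite -E -[RHS](mulr0 (r t)) -[in RHS](hf t); congr (_ * _).
by apply: eq_bigr => u _; rewrite mulVKf.
Qed.

(* Null spaces of bipartite graphs are graded by the bipartition. *)
Lemma null_adj_restrict (c : G -> bool) (b : bool) f :
  (forall u w, edge u w -> c w = ~~ c u) -> null_fun (adj_mx K G) f ->
  null_fun (adj_mx K G) (fun u => if c u == b then f u else 0).
Proof.
move=> hc hf t; rewrite adj_row; have [ct|ct] := boolP (c t == b).
  by apply: big1 => u /hc ->; rewrite -(eqP ct); case: (c t).
rewrite -[RHS](hf t) adj_row; apply: eq_bigr => u /hc ->.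
by case: (c t) b ct => -[].
Qed.

Lemma supp_indep M u w :
  graph_mx0 M -> edge u w -> u \in supp M -> w \notin supp M.
Proof.
move=> hM uw; rewrite -(supp_adj hM) => /suppP[x0 hx0 xu].
apply/negP => /suppP[y0 hy0 yw].
have [c hc] := forest_bipartite hG.
(* Keeping the colour class of [u] in one vector and that of [w] in the other leaves each nonzero at
   its own end and zero at the opposite end. *)
have := null_adj_restrict (c u) hc hx0; have := null_adj_restrict (c w) hc hy0.
set y := (X in null_fun _ X); set x := (X in _ -> null_fun _ X -> _) => hy hx.
have xw0 : x w = 0 by rewrite /x (hc _ _ uw); case: (c u).
have yu0 : y u = 0 by rewrite /y (hc _ _ uw); case: (c u).
have [C [uC wC hC]] := forest_edge_cut hG uw.
(* The rows of [f] at the vertices of [C], weighted by [g], sum to zero; the only edge leaving [C]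
   contributes [g u * f w]. *)
have cut f g : null_fun (adj_mx K G) f ->
    \sum_(t in C) \sum_(s in C | edge t s) g t * f s = - (g u * f w).
  move=> hf; apply/eqP; rewrite -addr_eq0; apply/eqP.
  transitivity (\sum_(t in C) g t * \sum_(s | edge t s) f s); last first.
    by apply: big1 => t _; rewrite -adj_row hf mulr0.
  rewrite (bigD1 u) //= [RHS](bigD1 u) //= addrAC; congr (_ + _).
    rewrite mulr_sumr [RHS](bigID (mem C)) /=; congr (_ + _).
      by apply: eq_bigl => s; rewrite andbC.
    rewrite (big_pred1 w) // => s; apply/idP/eqP => [/andP[us sC]|->].
      by have := hC _ _ uC us; rewrite (negbTE sC) eqxx => /eqP.
    by rewrite uw.
  apply: eq_bigr => t /andP[tC tu]; rewrite mulr_sumr; apply: eq_bigl => s.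
  have [ts|] := boolP (edge t s); rewrite ?andbT ?andbF //.
  by have := hC _ _ tC ts; rewrite (negbTE tu) orbF.
(* Adjacency within [C] is symmetric, so exchanging the two vectors preserves the sum. The two
   evaluations by [cut] then give x_u y_w = y_u x_w = 0, a contradiction. *)
have : \sum_(t in C) \sum_(s in C | edge t s) y t * x s
     = \sum_(t in C) \sum_(s in C | edge t s) x t * y s.
  rewrite (exchange_big_dep (mem C)) /=; last by move=> ? ? _ /andP[].
  apply: eq_bigr => s sC; apply: eq_big => [t|t _]; last exact: mulrC.
  by rewrite sC edge_sym.
rewrite cut // cut // xw0 mulr0 => /oppr_inj /esym /eqP.
by rewrite mulf_eq0 /x /y !eqxx (negbTE xu) (negbTE yw).
Qed.

(** * The scalation along edges and its effect on null vectors *)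

Section Scalation.
Variables (M : 'M[K]_#|G|) (U : {set G}).
Hypothesis hM : graph_mx0 M.

Lemma vertex_scal_rcons v u w : connect (@edge G) v u -> edge u w ->
  the_path v w = rcons (the_path v u) w ->
  vertex_scal M v w = vertex_scal M v u *
    (if u \in supp M then (mxentry M w u)^-1 else 1) *
    (if w \in supp M then mxentry M u w else 1).
Proof.
move=> cu uw e; rewrite /vertex_scal cu (connect_trans cu (connect1 uw)).
rewrite (arcs_rcons cu e) !big_rcons /=.
by rewrite mulrACA mulrA.
Qed.

(** Both orientations agree: if the path from [v] reaches [t] first, the arc (t,u) multiplies by the
    entry at (t,u); if it reaches [u] first, the arc (u,t) multiplies by the inverse of that same
    entry. *)
Lemma vertex_scal_edge v t u : connect (@edge G) v t -> edge t u ->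
  t \notin supp M -> u \in supp M ->
  vertex_scal M v u = vertex_scal M v t * mxentry M t u.
Proof.
move=> ct tu /negbTE tS uS; have cu := connect_trans ct (connect1 tu).
case: (the_path_edge hG ct tu) => e.
  by rewrite (vertex_scal_rcons ct tu e) tS uS mulr1.
rewrite edge_sym in tu.
rewrite (vertex_scal_rcons cu tu e) tS uS mulr1 mulfVK //.
by rewrite mxentry_neq0 // edge_sym.
Qed.

Lemma vertex_scal_neq0 v w : vertex_scal M v w != 0.
Proof.
rewrite /vertex_scal; case: ifP => [c|_]; last exact: oner_neq0.
have arcs_edge a : a \in arcs v w -> edge a.1 a.2.
  have /and3P[+ _ _] := the_pathP c; rewrite /arcs.
  move: (the_path v w) => p; elim: p v {c} => //= b p IH d /andP[db pp].
  by rewrite inE => /orP[/eqP ->//|]; apply: IH.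
rewrite mulf_neq0 // prodf_seq_neq0; apply/allP => a /arcs_edge e.
  by rewrite invr_eq0 mxentry_neq0 // edge_sym e implybT.
by rewrite mxentry_neq0 // e implybT.
Qed.

Definition scal w : K := \prod_(v in U) vertex_scal M v w.

Lemma scal_neq0 w : scal w != 0.
Proof. by apply/prodf_neq0 => v _; apply: vertex_scal_neq0. Qed.

Lemma cventry_scalation (x : 'cV[K]_#|G|) w :
  cventry (scalation M U *m x) w = scal w * cventry x w.
Proof. by rewrite /cventry /scalation mul_diag_mx !mxE enum_rankK. Qed.

Hypothesis hU : supp_transversal M U.

(** [U] meets the component of [u] in exactly one vertex [v], and the factors from vertices in other
    components are 1. *)
Lemma scal_component u : u \in supp M -> exists2 v, connect (@edge G) v u &
  forall w, connect (@edge G) u w -> scal w = vertex_scal M v w.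
Proof.
case: hU => _ U1 U2 uS.
have Cu : component u \in components G by apply: imset_f.
have /set0Pn[v] : U :&: component u != set0.
  by apply: U2 => //; apply/set0Pn; exists u; rewrite in_setI uS inE connect0.
rewrite !inE => /andP[vU uv]; exists v; first by rewrite edge_connect_sym.
move=> w uw; rewrite /scal (bigD1 v) //= big1 ?mulr1 // => v' /andP[v'U v'v].
rewrite /vertex_scal ifN //; apply/negP => v'w.
have uv' : connect (@edge G) u v'.
  by apply: connect_trans uw _; rewrite edge_connect_sym.
have /card_le1_eqP e := U1 _ Cu.
by move/eqP: v'v; apply; apply: e; rewrite !inE ?v'U ?vU.
Qed.

Lemma scal_edge t u : edge t u -> t \notin supp M -> u \in supp M ->
  scal u = scal t * mxentry M t u.
Proof.
move=> tu tS uS; have [v vu sv] := scal_component uS.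
have ut : connect (@edge G) u t by rewrite connect1 // edge_sym.
by rewrite !sv ?connect0 //; apply: vertex_scal_edge; rewrite ?(connect_trans vu).
Qed.

(** Vanishing off the support is assumed of [f] itself, so that it can be derived from either null
    space according to the direction in use. *)
Lemma null_scal f : (forall u, u \notin supp M -> f u = 0) ->
  null_fun (adj_mx K G) (fun u => scal u * f u) <-> null_fun M f.
Proof.
move=> f0.
(* By independence all neighbours of a supported [t] are unsupported, where [f] is zero. The
   arbitrary weights [g] cover the rows of both matrices. *)
have tS t g : t \in supp M -> \sum_(u | edge t u) g u * f u = 0.
  by move=> tS; apply: big1 => u /supp_indep uS; rewrite f0 ?mulr0 // uS.
have E t : t \notin supp M ->
    \sum_u mxentry (adj_mx K G) t u * (scal u * f u)
    = scal t * \sum_u mxentry M t u * f u.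
  move=> nS; rewrite adj_row graph_mx0_row // mulr_sumr; apply: eq_bigr => u tu.
  have [uS|/f0 ->] := boolP (u \in supp M); last by rewrite !mulr0.
  by rewrite (scal_edge tu) // mulrA.
split=> h t; have [/tS h0|nS] := boolP (t \in supp M).
- by rewrite graph_mx0_row // h0.
- by apply: (mulfI (scal_neq0 t)); rewrite -E // h mulr0.
- by rewrite adj_row h0.
- by rewrite E // h mulr0.
Qed.

End Scalation.

(** * Existence of supp-transversal sets, and the equivalence *)

Lemma supp_transversal_exists M : exists U, supp_transversal M U.
Proof.
(* [rep v] depends only on the component of [v], so the vertices chosen as their own representative
   form a transversal. *)
pose rep v := [pick z in supp M :&: component v].
have compE u v : connect (@edge G) u v -> component u = component v.
  move=> uv; apply/setP => w; rewrite !inE.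
  exact: (same_connect (@edge_connect_sym G) uv).
exists [set v in supp M | rep v == Some v]; split.
- by apply/subsetP => v; rewrite inE => /andP[].
- move=> _ /imsetP[v _ ->]; apply/card_le1_eqP => a b.
  rewrite !inE => /andP[/andP[_ /eqP ra] va] /andP[/andP[_ /eqP rb] vb].
  by apply: Some_inj; rewrite -ra -rb /rep -(compE _ _ va) -(compE _ _ vb).
move=> _ /imsetP[v _ ->] /set0Pn[z zS].
have [y ry yS] : exists2 y, rep v = Some y & y \in supp M :&: component v.
  by rewrite /rep; case: pickP => [y yS|/(_ z)]; [exists y | rewrite zS].
move: yS; rewrite in_setI [y \in component v]inE => /andP[yS vy].
by apply/set0Pn; exists y; rewrite in_setI in_set yS inE vy /rep -(compE _ _ vy)
  -/(rep v) ry eqxx.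
Qed.

End NullSpaces.

Theorem corollary5 (K : fieldType) (G : sgraph) (M : 'M[K]_#|G|)
    (x : 'cV[K]_#|G|) (hG : forest G) (hM : graph_mx0 M) :
  x \in null M <->
  (forall U : {set G}, supp_transversal M U ->
     scalation M U *m x \in null (adj_mx K G)).
Proof.
have E U : null_fun (adj_mx K G) (cventry (scalation M U *m x)) <->
           null_fun (adj_mx K G) (fun u => scal M U u * cventry x u).
  by split=> h t; rewrite -[RHS](h t); apply: eq_bigr => u _;
    rewrite cventry_scalation.
split=> [/nullP hx U hU|h].
  apply/nullP/E/null_scal => // u /suppP uS.
  by apply/eqP; apply: contra_notT uS => xu; exists (cventry x).
(* A single supp-transversal set suffices here; its existence keeps the hypothesis from being
   vacuous. *)
have [U hU] := supp_transversal_exists M.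
have /nullP/E hx := h U hU.
(* [x] vanishes off the support of [M]: its scalation is a null vector of the adjacency matrix,
   which has the same support, and the scaling factors are nonzero. *)
apply/nullP/(null_scal hG hM hU) => // u; rewrite -(supp_adj hG hM) => /suppP uS.
apply/eqP; apply: contra_notT uS => xu.
exists (fun u => scal M U u * cventry x u) => //.
by rewrite mulf_neq0 // scal_neq0.
Qed.
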